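(* Fix constants $\sigma_f^2>0$, $\sigma_a^2\ge 0$ and $\alpha\in\mathbb{R}$ with $|\alpha|\le\sigma_f$, and an integer $n\ge 1$. Let $\mathcal{C}$ be the class of all distributions (in the sense of the context) with $\operatorname{Var}(f(z))=\sigma_f^2$, $\mathbb{E}_z[\operatorname{Var}(Y(z))]=\sigma_a^2$ and $\operatorname{Cov}(f(z),g(z))=\alpha$. Let $\rho=\alpha/\sigma_f$ and define the control variates estimator $$\hat\mu_{\mathrm{cv}}=\frac{1}{n}\sum_{i=1}^n \bigl(y^{(i)}-\alpha\, g(z^{(i)})\bigr).$$ Then (i) for every distribution in $\mathcal{C}$, $$\operatorname{Var}(\hat\mu_{\mathrm{cv}})=\frac{1}{n}\bigl(\sigma_f^2(1-\rho^2)+\sigma_a^2\bigr);$$ and (ii) for every estimator $\hat\mu$ that is a (measurable) function of $(y^{(i)},g(z^{(i)}))_{i=1}^n$ and is unbiased for $\mu$ (i.e. $\mathbb{E}[\hat\mu]=\mu$) under every distribution in $\mathcal{C}$, one has $$\sup_{\mathcal{C}}\operatorname{Var}(\hat\mu)\ \ge\ \frac{1}{n}\bigl(\sigma_f^2(1-\rho^2)+\sigma_a^2\bigr)=\sup_{\mathcal{C}}\operatorname{Var}(\hat\mu_{\mathrm{cv}}),$$ i.e. no unbiased estimator has lower worst-case variance than $\hat\mu_{\mathrm{cv}}$.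
   Context: Setting: a ''distribution'' consists of a random input $z$ taking values in some measurable space (in the paper's application, $z$ is uniform over a finite set of system outputs), a measurable real function $g$ (the automatic metric) normalized so that $\mathbb{E}[g(z)]=0$ and $\operatorname{Var}(g(z))=1$, and, for each $z$, a real random variable $Y(z)$ (a human judgment) with finite second moment. Define the human metric $f(z)=\mathbb{E}[Y(z)\mid z]$, the target $\mu=\mathbb{E}_z[f(z)]$, $\sigma_f^2=\operatorname{Var}(f(z))$ and $\sigma_a^2=\mathbb{E}_z[\operatorname{Var}(Y(z)\mid z)]$. Sampling: $z^{(1)},\dots,z^{(n)}$ are drawn independently from the distribution of $z$, and given them $y^{(i)}=Y(z^{(i)})$ are drawn independently (human judgments on different samples are independent given the $z^{(i)}$). The constant $\alpha$ is treated as known. *)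

(* Defs.v *)
From HB Require Import structures.
From mathcomp Require Import all_boot all_order all_algebra.
From mathcomp Require Import all_classical all_reals all_analysis.
Set Implicit Arguments.
Unset Strict Implicit.
Unset Printing Implicit Defensive.
Import Order.TTheory GRing.Theory Num.Theory.
Local Open Scope classical_set_scope.
Local Open Scope ring_scope.

Section tuple_product.
Context {d} {X : measurableType d} {R : realType}.

Definition tcons (n : nat) (p : X * n.-tuple X) : n.+1.-tuple X :=
  [tuple of p.1 :: p.2].

Lemma measurable_tcons n : measurable_fun [set: X * n.-tuple X] (@tcons n).
Proof. exact: measurable_cons. Qed.

HB.instance Definition _ n :=
  isMeasurableFun.Build _ _ _ _ (@tcons n) (@measurable_tcons n).

Fixpoint tprod (P : probability X R) (n : nat) : probability (n.-tuple X) R :=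
  match n with
  | 0 => [the probability _ R of @dirac _ (0.-tuple X) [tuple] R]
  | m.+1 => [the probability _ R of
              distribution ((P \x tprod P m)%E) (@tcons m)]
  end.

End tuple_product.

(* A "distribution" of the paper: z ~ Pz on a measurable space T;      *)
(* the human judgment is Y(z) = phi (z, u) where u ~ Q is an           *)
(* independent source of randomness on a measurable space U (so Y(z)   *)
(* is, for each z, a real random variable on (U, Q)); g is the         *)
(* automatic metric.                                                   *)
Section distribution_model.
Context {dT dU} {T : measurableType dT} {U : measurableType dU} {R : realType}.
Variables (Pz : probability T R) (Q : probability U R).
Variables (phi : T * U -> R) (g : T -> R).
Local Open Scope ereal_scope.

Definition Yz (z : T) : U -> R := fun u => phi (z, u).

Definition hmetric (z : T) : R := fine 'E_Q[Yz z].

Definition target : \bar R := 'E_Pz[hmetric].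

Definition condvar (z : T) : R := fine 'V_Q[Yz z].

(* membership in the class C(sf, sa2, alpha): Var f = sf^2,
   E_z[Var(Y(z)|z)] = sa2, Cov(f, g) = alpha, plus the standing
   assumptions of the context (measurability, E g = 0, Var g = 1,
   each Y(z) has finite second moment). *)
Definition in_class (sf sa2 alpha : R) : Prop :=
  [/\ measurable_fun [set: T * U] phi /\ measurable_fun [set: T] g,
      'E_Pz[g] = 0%:E /\ 'V_Pz[g] = 1%:E,
      (forall z, Yz z \in Lfun Q 2%:E),
      'V_Pz[hmetric] = (sf ^+ 2)%:E /\ 'E_Pz[condvar] = sa2%:E &
      covariance Pz hmetric g = alpha%:E].

Definition sampleP (n : nat) : probability (n.-tuple (T * U)) R :=
  tprod (Pz \x Q)%E n.

Definition observations (n : nat) (w : n.-tuple (T * U)) : n.-tuple (R * R) :=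
  map_tuple (fun p => (phi p, g p.1)) w.

Definition estimator (n : nat) (h : n.-tuple (R * R) -> R)
  (w : n.-tuple (T * U)) : R := h (observations w).

Definition mu_cv (alpha : R) (n : nat) (w : n.-tuple (T * U)) : R :=
  (n%:R^-1 * \sum_(i < n) (phi (tnth w i) - alpha * g (tnth w i).1))%R.

End distribution_model.

Definition cv_bound {R : realType} (sf sa2 alpha : R) (n : nat) : R :=
  n%:R^-1 * (sf ^+ 2 * (1 - (alpha / sf) ^+ 2) + sa2).

(* Main.v *)
(** (i) Conditionally on z, the residual Y(z) - alpha g(z) has mean
    f(z) - alpha g(z) and the variance of Y(z); the law of total variance gives
    sf^2 - alpha^2 + sa2 for one residual.

    (ii) Let f = alpha g + b xi and Y = f + sqrt(sa2) e, where b^2 = sf^2 - alpha^2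
    and g, xi, e are independent with unit variance.  Giving xi the mean b tau and e
    the mean sqrt(sa2) tau moves the target from 0 to tau v, v = b^2 + sa2, within
    the class.  For suitable laws of xi and e on a fixed three-point support, the
    chi-square divergence of the law with mean t from the centred one is
    t^2 + O(t^4), so that of n observations is n v tau^2 + O(tau^4), and the
    Chapman-Robbins inequality bounds the variance of an unbiased estimator at
    tau = 0 below by (tau v)^2 / (n v tau^2 + O(tau^4)), which tends to v / n. *)

Require Import Defs.
From HB Require Import structures.
From mathcomp Require Import all_boot all_order all_algebra.
From mathcomp Require Import all_classical all_reals all_analysis.
From mathcomp Require Import measurable_realfun ring lra.
Import Order.TTheory GRing.Theory Num.Theory.
Local Open Scope classical_set_scope.
Local Open Scope ring_scope.
Set Implicit Arguments.
Unset Strict Implicit.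
Unset Printing Implicit Defensive.

(** * Moments of i.i.d. samples *)

Section moments.
Context {d} {T : measurableType d} {R : realType} (P : probability T R).

Lemma Lfun_add (p : R) (f g : T -> R) : 1 <= p ->
  f \in Lfun P p%:E -> g \in Lfun P p%:E -> f \+ g \in Lfun P p%:E.
Proof. by rewrite -lee_fin => p1 fp gp; apply: rpredD. Qed.

Lemma Lfun_sub (p : R) (f g : T -> R) : 1 <= p ->
  f \in Lfun P p%:E -> g \in Lfun P p%:E -> f \- g \in Lfun P p%:E.
Proof. by rewrite -lee_fin => p1 fp gp; apply: rpredB. Qed.

Lemma sqr_lty_Lfun2 (f : T -> R) : measurable_fun [set: T] f ->
  (\int[P]_x (f x ^+ 2)%:E < +oo)%E -> f \in Lfun P 2%:E.
Proof.
move=> mf foo; rewrite inE; apply/andP; split; rewrite inE//=.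
rewrite /finite_norm unlock /Lnorm poweR_lty//=.
by under eq_integral => x _ do rewrite powR_mulrn// real_normK ?num_real//.
Qed.

Lemma Lfun2_Lfun1 (f : T -> R) : f \in Lfun P 2%:E -> f \in Lfun P 1.
Proof. by move=> f2; apply: Lfun_subset12 f2; rewrite fin_num_measure. Qed.

Lemma Lfun2_measurable (f : T -> R) : f \in Lfun P 2%:E ->
  measurable_fun [set: T] f.
Proof. by rewrite inE => /andP[]; rewrite inE. Qed.

Lemma variance_integral (f : T -> R) (m : R) : 'E_P[f]%E = m%:E ->
  'V_P[f]%E = (\int[P]_x ((f x - m) ^+ 2)%:E)%E.
Proof.
move=> fm; rewrite /variance covariance.unlock expectation.unlock.
rewrite expectation.unlock in fm.
by apply: eq_integral => x _; rewrite fm /= expr2.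
Qed.

(** By definition the variance is the integral of [(f - c) ^ 2] with [c = fine 'E_P[f]], whichever
    value [fine] returns. Its finiteness puts [f - c] in L2, and constants are in L2 of a
    probability. *)
Lemma variance_lty_Lfun2 (f : T -> R) : measurable_fun [set: T] f ->
  ('V_P[f] < +oo)%E -> f \in Lfun P 2%:E.
Proof.
move=> mf Voo; set c := fine 'E_P[f]%E.
have -> : f = (f \- cst c) \+ cst c by apply/funext => x /=; rewrite subrK.
apply: Lfun_add; [by rewrite ler1n| |exact: Lfun_cst].
apply: sqr_lty_Lfun2; first exact: measurable_funB.
move: Voo; rewrite /variance covariance.unlock expectation.unlock.
congr (_ < _)%E; apply: eq_integral => x _.
by rewrite /= /c expectation.unlock expr2.
Qed.

(** The cross term [2 c f] integrates to zero because [f] is centred. This serves to integrate out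
    one variable while [c] collects everything that is held fixed. *)
Lemma integral_sqrD (f : T -> R) (c v : R) : f \in Lfun P 2%:E ->
  'E_P[f]%E = 0%E -> (\int[P]_x (f x ^+ 2)%:E = v%:E)%E ->
  (\int[P]_x ((c + f x) ^+ 2)%:E = (c ^+ 2 + v)%:E)%E.
Proof.
move=> f2 f0 fv.
have f1 := Lfun2_Lfun1 f2.
have ->: (\int[P]_x ((c + f x) ^+ 2)%:E =
   'E_P[(cst (c ^+ 2) \+ (c *+ 2) \o* f \+ (fun x => f x ^+ 2))%R])%E.
  rewrite expectation.unlock; apply: eq_integral => x _ /=; congr EFin; ring.
have fsq : (fun x => f x ^+ 2) \in Lfun P 1.
  exact/Lfun1_integrable/Lfun2_integrable_sqr.
rewrite !expectationD ?Lfun_add ?Lfun_scale ?Lfun_cst//.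
rewrite expectation_cst expectationZl// f0 mule0 adde0.
by rewrite expectation.unlock fv.
Qed.

End moments.

Section product_samples.
Context {d} {X : measurableType d} {R : realType} (P : probability X R).
Local Open Scope ereal_scope.

Lemma ge0_integral_tprodS n (F : n.+1.-tuple X -> \bar R) :
  measurable_fun [set: n.+1.-tuple X] F -> (forall w, 0 <= F w) ->
  \int[tprod P n.+1]_w F w =
    \int[P]_x \int[tprod P n]_w F (tcons (x, w)).
Proof.
move=> mF F0 /=; rewrite ge0_integral_distribution//.
rewrite (fubini_tonelli1 (F \o @tcons _ X n))//=.
by apply: measurableT_comp => //; exact: measurable_tcons.
Qed.

Lemma integral_tprodS n (F : n.+1.-tuple X -> \bar R) :
  (tprod P n.+1).-integrable [set: n.+1.-tuple X] F ->
  \int[tprod P n.+1]_w F w =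
    \int[P]_x \int[tprod P n]_w F (tcons (x, w)).
Proof.
move=> iF; have mF := measurable_int _ iF.
have iFt : (P \x tprod P n).-integrable [set: X * n.-tuple X]
    (F \o @tcons _ X n).
  apply/integrableP; split.
    by apply: measurableT_comp => //; exact: measurable_tcons.
  move/integrableP: iF => [_]; congr (_ < _) => /=.
  by rewrite ge0_integral_distribution//; exact: measurableT_comp.
by rewrite /= integral_distribution// -integral12_prod_meas1.
Qed.

Definition sample_sum (f : X -> R) n (w : n.-tuple X) : R :=
  (\sum_(i < n) f (tnth w i))%R.

Lemma sample_sum_tcons (f : X -> R) n x (w : n.-tuple X) :
  sample_sum f (tcons (x, w)) = (f x + sample_sum f w)%R.
Proof.
rewrite /sample_sum big_ord_recl tnth0/=; congr (_ + _)%R.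
by apply: eq_bigr => i _; rewrite tnthS.
Qed.

Lemma measurable_sample_sum (f : X -> R) n : measurable_fun [set: X] f ->
  measurable_fun [set: n.-tuple X] (@sample_sum f n).
Proof.
move=> mf; apply: measurable_sum => i.
by apply: measurableT_comp => //; exact: measurable_tnth.
Qed.

(** The three claims go through one induction: with the first observation [x] frozen,
    [integral_sqrD] for [c = f x] gives [f x ^ 2 + n v], and integrating over [x] adds one more [v].
    It needs the mean and integrability of the shorter sum. *)
Lemma sample_sum_moments (f : X -> R) (v : R) n : f \in Lfun P 2%:E ->
  'E_P[f] = 0 -> \int[P]_x (f x ^+ 2)%:E = v%:E ->
  [/\ @sample_sum f n \in Lfun (tprod P n) 2%:E,
      'E_(tprod P n)[@sample_sum f n] = 0 &
      \int[tprod P n]_w (sample_sum f w ^+ 2)%:E = (n%:R * v)%:E].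
Proof.
move=> f2 f0 fv; have mf := Lfun2_measurable f2.
elim: n => [|n [S2 S0 Sv]].
  have -> : @sample_sum f 0 = cst 0%R.
    by apply/funext => w; rewrite /sample_sum big_ord0.
  rewrite Lfun_cst expectation_cst; split=> //.
  by rewrite integral0_eq ?mul0r// => w _; rewrite expr0n.
have mS := @measurable_sample_sum f n.+1 mf.
have v' : \int[tprod P n.+1]_w (sample_sum f w ^+ 2)%:E = (n.+1%:R * v)%:E.
  rewrite ge0_integral_tprodS; last 2 first.
  - by apply/measurable_EFinP; exact: measurable_funX.
  - by move=> w; rewrite lee_fin sqr_ge0.
  under eq_integral => x _.
    under eq_integral do rewrite sample_sum_tcons.
    rewrite (integral_sqrD _ S2 S0 Sv) EFinD.
    over.
  rewrite ge0_integralD//=; last 3 first.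
  - by move=> x _; rewrite lee_fin sqr_ge0.
  - by apply/measurable_EFinP; exact: measurable_funX.
  - by move=> x _; rewrite -Sv integral_ge0// => w _; rewrite lee_fin sqr_ge0.
  rewrite fv integral_cst//= probability_setT mule1 -EFinD.
  by rewrite -natr1 mulrDl mul1r addrC.
(* The second moment came from Tonelli; its finiteness now gives the integrability that Fubini
   requires for the mean. *)
have S2' : @sample_sum f n.+1 \in Lfun (tprod P n.+1) 2%:E.
  by apply: sqr_lty_Lfun2 => //; rewrite v' ltry.
split => //.
have S1 := (Lfun1_integrable _ _).1 (Lfun2_Lfun1 S2').
rewrite expectation.unlock integral_tprodS//.
rewrite -[RHS]f0 expectation.unlock; apply: eq_integral => x _.
under eq_integral do rewrite sample_sum_tcons.
rewrite -[LHS]/(\int[tprod P n]_w ((cst (f x) \+ @sample_sum f n)%R w)%:E).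
have := expectationD (Lfun_cst (tprod P n) (f x) 1) (Lfun2_Lfun1 S2).
by rewrite expectation_cst S0 adde0 expectation.unlock.
Qed.

Lemma variance_sample_mean (f : X -> R) n : (0 < n)%N -> f \in Lfun P 2%:E ->
  'V_(tprod P n)[(fun w => n%:R^-1 * sample_sum f w)%R] =
  n%:R^-1%:E * 'V_P[f].
Proof.
move=> n0 f2; have Ef := expectation_fin_num (Lfun2_Lfun1 f2).
have nn : n%:R != 0%R :> R by rewrite pnatr_eq0 -lt0n.
set m := fine 'E_P[f].
have fm : 'E_P[f] = m%:E by rewrite fineK.
pose f' := (f \- cst m)%R.
have f'2 : f' \in Lfun P 2%:E by rewrite Lfun_sub ?ler1n// Lfun_cst.
have f'0 : 'E_P[f'] = 0.
  by rewrite expectationB ?Lfun_cst ?Lfun2_Lfun1// expectation_cst fm subee.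
set v := fine 'V_P[f].
have fv : 'V_P[f] = v%:E by rewrite fineK// variance_fin_num.
have f'v : \int[P]_x (f' x ^+ 2)%:E = v%:E by rewrite -(variance_integral fm).
have [S2 S0 Sv] := @sample_sum_moments f' v n f'2 f'0 f'v.
have SE : (fun w : n.-tuple X => n%:R^-1 * sample_sum f w)%R =
    (cst m \+ n%:R^-1 \o* @sample_sum f' n)%R.
  apply/funext => w /=; rewrite /sample_sum /f' sumrB.
  rewrite sumr_const card_ord -mulr_natr/=; field.
  exact: nn.
rewrite SE varianceD_cst_l ?Lfun_scale ?ler1n// varianceZ// (variance_integral S0).
under eq_integral do rewrite subr0.
rewrite Sv fv -!EFinM; congr EFin; field; exact: nn.
Qed.

End product_samples.

(** * Variance of the control variates estimator *)

Section control_variates_variance.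
Context {dT dU} {T : measurableType dT} {U : measurableType dU} {R : realType}.
Context (Pz : probability T R) (Q : probability U R).
Context (phi : T * U -> R) (g : T -> R).
Local Open Scope ereal_scope.

(** Positive and negative parts turn the inner integral into a difference of two Tonelli integrals,
    each measurable in [z]. *)
Lemma measurable_hmetric : measurable_fun [set: T * U] phi ->
  measurable_fun [set: T] (hmetric Q phi).
Proof.
move=> mphi; have mE : measurable_fun [set: T * U] (EFin \o phi).
  exact/measurable_EFinP.
apply: measurableT_comp => //; rewrite expectation.unlock.
have -> : (fun z => \int[Q]_u (Yz phi z u)%:E) =
    fubini_F Q (EFin \o phi)^\+ \- fubini_F Q (EFin \o phi)^\-.
  apply/funext => z; rewrite [LHS]integralE /fubini_F.
  by congr (_ - _); apply: eq_integral => u _; rewrite ?funeposE ?funenegE.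
apply: emeasurable_funB.
  by apply: measurable_fun_fubini_tonelli_F => //; exact: measurable_funepos.
by apply: measurable_fun_fubini_tonelli_F => //; exact: measurable_funeneg.
Qed.

Context (mphi : measurable_fun [set: T * U] phi).
Context (phi2 : forall z, Yz phi z \in Lfun Q 2%:E).

Let f := hmetric Q phi.

Let mf : measurable_fun [set: T] f. Proof. exact: measurable_hmetric. Qed.

Let Ef z : 'E_Q[Yz phi z] = (f z)%:E.
Proof. by rewrite fineK// expectation_fin_num// Lfun2_Lfun1. Qed.

Let Vf z : \int[Q]_u ((phi (z, u) - f z) ^+ 2)%:E = (condvar Q phi z)%:E.
Proof.
by rewrite fineK ?variance_fin_num// (variance_integral (Ef z)).
Qed.

Let measurable_sqr : measurable_fun [set: T * U]
  (fun p => ((phi p - f p.1) ^+ 2)%:E).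
Proof.
apply/measurable_EFinP; apply: measurable_funX; apply: measurable_funB => //.
exact: measurableT_comp.
Qed.

Lemma measurable_condvar : measurable_fun [set: T] (condvar Q phi).
Proof.
apply/measurable_EFinP.
have -> : EFin \o condvar Q phi =
    fubini_F Q (fun p => ((phi p - f p.1) ^+ 2)%:E).
  by apply/funext => z; rewrite /= -Vf.
by apply: measurable_fun_fubini_tonelli_F => // p; rewrite lee_fin sqr_ge0.
Qed.

(** For fixed [z], [Y - k z] is the constant [f z - k z] plus the centred variable [Y - f z], so the
    cross term vanishes. The function [k] is left free so that raw and centred second moments are
    both instances. *)
Lemma integral_sqr_residual (k : T -> R) : measurable_fun [set: T] k ->
  \int[Pz \x Q]_p ((phi p - k p.1) ^+ 2)%:E =
  \int[Pz]_z ((f z - k z) ^+ 2)%:E + 'E_Pz[condvar Q phi].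
Proof.
move=> mk.
rewrite (fubini_tonelli1 (fun p => ((phi p - k p.1) ^+ 2)%:E)); last 2 first.
- apply/measurable_EFinP; apply: measurable_funX; apply: measurable_funB => //.
  exact: measurableT_comp.
- by move=> p; rewrite lee_fin sqr_ge0.
rewrite expectation.unlock -ge0_integralD//; last 4 first.
- by move=> z _; rewrite lee_fin sqr_ge0.
- by apply/measurable_EFinP; apply: measurable_funX; exact: measurable_funB.
- by move=> z _; rewrite -Vf integral_ge0// => u _; rewrite lee_fin sqr_ge0.
- exact/measurable_EFinP/measurable_condvar.
apply: eq_integral => z _; rewrite /fubini_F /=.
have Y2 : (Yz phi z \- cst (f z))%R \in Lfun Q 2%:E.
  by rewrite Lfun_sub ?ler1n// Lfun_cst.
have Y0 : 'E_Q[(Yz phi z \- cst (f z))%R] = 0.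
  by rewrite expectationB ?Lfun_cst ?Lfun2_Lfun1// expectation_cst Ef subee.
rewrite -EFinD -(integral_sqrD (f z - k z)%R Y2 Y0 (Vf z)).
by apply: eq_integral => u _ /=; congr (_ ^+ 2)%:E; rewrite /Yz; ring.
Qed.

Lemma variance_residual (sf sa2 alpha : R) :
  in_class Pz Q phi g sf sa2 alpha ->
  (fun p => phi p - alpha * g p.1)%R \in Lfun (Pz \x Q) 2%:E /\
  'V_(Pz \x Q)[(fun p => phi p - alpha * g p.1)%R] =
    (sf ^+ 2 - alpha ^+ 2 + sa2)%:E.
Proof.
move=> [[_ mg] [Eg Vg] _ [Vhf Ecv] Cfg].
have f2 : f \in Lfun Pz 2%:E by apply: variance_lty_Lfun2; rewrite // Vhf ltry.
have g2 : g \in Lfun Pz 2%:E by apply: variance_lty_Lfun2; rewrite // Vg ltry.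
have ag2 : (alpha \o* g)%R \in Lfun Pz 2%:E by rewrite Lfun_scale// ler1n.
have fag2 : (f \- alpha \o* g)%R \in Lfun Pz 2%:E by rewrite Lfun_sub ?ler1n.
set X := (X in X \in _).
have mX : measurable_fun [set: T * U] X.
  apply: measurable_funB => //; apply: measurable_funM => //.
  exact: measurableT_comp.
(* Taken at [c = 0] this shows that the residual is square integrable; taken at its mean it gives
   the variance. *)
have XE c : \int[Pz \x Q]_p ((X p - c) ^+ 2)%:E =
    \int[Pz]_z (((f \- alpha \o* g)%R z - c) ^+ 2)%:E + sa2%:E.
  rewrite -Ecv.
  under [in RHS]eq_integral do rewrite /= -addrA -opprD.
  rewrite -(integral_sqr_residual (k := fun z => (g z * alpha + c)%R)).
    by apply: eq_integral => p _; congr (_ ^+ 2)%:E; rewrite /X; ring.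
  by apply: measurable_funD => //; exact: measurable_funM.
have X2 : X \in Lfun (Pz \x Q) 2%:E.
  apply: sqr_lty_Lfun2 => //; have := XE 0%R.
  under eq_integral do rewrite subr0.
  move=> ->; under eq_integral do rewrite subr0.
  rewrite lte_add_pinfty ?ltry//.
  exact/(integrable_lty measurableT)/Lfun2_integrable_sqr.
split=> //.
have EX : 'E_(Pz \x Q)[X] = 'E_Pz[(f \- alpha \o* g)%R].
  rewrite expectation.unlock -integral12_prod_meas1; last first.
    exact/Lfun1_integrable/Lfun2_Lfun1.
  apply: eq_integral => z _; rewrite /fubini_F /=.
  have := expectationB (Lfun2_Lfun1 (phi2 z)) (Lfun_cst Q (g z * alpha)%R 1).
  rewrite Ef expectation_cst expectation.unlock => EfB.
  rewrite -[RHS]/((f z)%:E - (g z * alpha)%:E) -EfB.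
  by apply: eq_integral => u _ /=; rewrite /X mulrC.
have EXf : 'E_Pz[(f \- alpha \o* g)%R] = (fine 'E_Pz[(f \- alpha \o* g)%R])%:E.
  by rewrite fineK// expectation_fin_num// Lfun2_Lfun1.
rewrite EXf in EX; rewrite (variance_integral EX) XE -(variance_integral EXf).
(* It remains to expand [Var f + alpha ^ 2 Var g - 2 alpha Cov(f, g)], which is [sf ^ 2 - alpha ^ 2]
   in the class. *)
have fg1 := Lfun2_mul_Lfun1 f2 g2.
rewrite varianceB// varianceZ//.
rewrite (covarianceZr _ (Lfun2_Lfun1 f2) (Lfun2_Lfun1 g2) fg1).
rewrite Vhf Vg Cfg -!EFinM -!EFinD; congr EFin; ring.
Qed.

End control_variates_variance.

(** * Densities and the Chapman-Robbins inequality *)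

Section density.
Local Open Scope ereal_scope.

(** Testing against nonnegative functions instead of sets lets the property pass to products
    directly by Tonelli. *)
Definition has_density {d} {X : measurableType d} {R : realType}
    (P P' : probability X R) (L : X -> R) :=
  [/\ measurable_fun [set: X] L, forall x, (0 <= L x)%R &
  forall F : X -> \bar R, measurable_fun [set: X] F -> (forall x, 0 <= F x) ->
    \int[P']_x F x = \int[P]_x (F x * (L x)%:E)].

Lemma has_density_prod {d1 d2} {X : measurableType d1} {Y : measurableType d2}
    {R : realType} (P P' : probability X R) (Q Q' : probability Y R)
    (L : X -> R) (M : Y -> R) :
  has_density P P' L -> has_density Q Q' M ->
  has_density (P \x Q) (P' \x Q') (fun p => L p.1 * M p.2)%R.
Proof.
move=> [mL L0 LE] [mM M0 ME].
have mLM : measurable_fun [set: X * Y] (fun p => L p.1 * M p.2)%R.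
  by apply: measurable_funM; exact: measurableT_comp.
split=> // [p|F mF F0]; first exact: mulr_ge0.
have mFM : measurable_fun [set: X * Y] (fun p => F p * (M p.2)%:E).
  apply: emeasurable_funM => //; apply/measurable_EFinP.
  exact: measurableT_comp.
have FM0 p : 0 <= F p * (M p.2)%:E by rewrite mule_ge0 ?lee_fin.
rewrite (fubini_tonelli1 F)//.
rewrite (fubini_tonelli1 (fun p => F p * (L p.1 * M p.2)%:E)); last 2 first.
- by apply: emeasurable_funM => //; exact/measurable_EFinP.
- by move=> p; rewrite mule_ge0 ?lee_fin ?mulr_ge0.
transitivity (\int[P']_x fubini_F Q (fun p => F p * (M p.2)%:E) x).
  apply: eq_integral => x _; rewrite /fubini_F ME//.
  exact: measurableT_comp.
rewrite LE; last 2 first.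
- exact: measurable_fun_fubini_tonelli_F.
- by move=> x; apply: integral_ge0.
apply: eq_integral => x _; rewrite /fubini_F -ge0_integralZr//; last 2 first.
- exact: (measurableT_comp mFM).
- by rewrite lee_fin.
by apply: eq_integral => y _ /=; rewrite EFinM muleAC muleA.
Qed.

Definition sample_prod {X : Type} {R : realType} (L : X -> R) n
  (w : n.-tuple X) : R := (\prod_(i < n) L (tnth w i))%R.

Lemma sample_prod_tcons {d} {X : measurableType d} {R : realType}
    (L : X -> R) n x (w : n.-tuple X) :
  sample_prod L (tcons (x, w)) = (L x * sample_prod L w)%R.
Proof.
rewrite /sample_prod big_ord_recl tnth0/=; congr (_ * _)%R.
by apply: eq_bigr => i _; rewrite tnthS.
Qed.

Lemma measurable_sample_prod {d} {X : measurableType d} {R : realType}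
    (L : X -> R) n : measurable_fun [set: X] L ->
  measurable_fun [set: n.-tuple X] (@sample_prod X R L n).
Proof.
move=> mL; apply: measurable_prod => i _.
by apply: measurableT_comp => //; exact: measurable_tnth.
Qed.

Lemma has_density_tprod {d} {X : measurableType d} {R : realType}
    (P P' : probability X R) (L : X -> R) n :
  has_density P P' L ->
  has_density (tprod P n) (tprod P' n) (@sample_prod X R L n).
Proof.
move=> PP'; have [mL L0 LE] := PP'.
have mS k := @measurable_sample_prod _ X R L k mL.
have S0 k (w : k.-tuple X) : (0 <= sample_prod L w)%R by exact: prodr_ge0.
elim: n => [|n IH]; split; [exact: mS|exact: S0| |exact: mS|exact: S0|]
  => F mF F0.
  apply: eq_integral => w _.
  by rewrite /sample_prod big_ord0 mule1.
have [_ _ PPn] := has_density_prod PP' IH.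
have mFS : measurable_fun [set: n.+1.-tuple X]
    (fun w => F w * (sample_prod L w)%:E).
  apply: emeasurable_funM; first exact: mF.
  by apply/measurable_EFinP; exact: mS.
have FS0 w : 0 <= F w * (sample_prod L w)%:E by rewrite mule_ge0// lee_fin.
rewrite /= !ge0_integral_distribution//.
rewrite (PPn (F \o @tcons _ X n)); [|exact: measurableT_comp|by move=> p /=].
by apply: eq_integral => -[x w] _ /=; rewrite sample_prod_tcons.
Qed.

Lemma ge0_integral_prodM {d1 d2} {X : measurableType d1}
    {Y : measurableType d2} {R : realType} (P : probability X R)
    (Q : probability Y R) (f : X -> R) (g : Y -> R) (a b : R) :
  measurable_fun [set: X] f -> measurable_fun [set: Y] g ->
  (forall x, 0 <= f x)%R -> (forall y, 0 <= g y)%R ->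
  \int[P]_x (f x)%:E = a%:E -> \int[Q]_y (g y)%:E = b%:E ->
  \int[P \x Q]_p (f p.1 * g p.2)%:E = (a * b)%:E.
Proof.
move=> mf mg f0 g0 fa gb.
rewrite (fubini_tonelli1 (fun p => (f p.1 * g p.2)%:E)); last 2 first.
- by apply/measurable_EFinP; apply: measurable_funM; exact: measurableT_comp.
- by move=> p; rewrite lee_fin mulr_ge0.
transitivity (\int[P]_x (b%:E * (f x)%:E)).
  apply: eq_integral => x _; rewrite /fubini_F /=.
  under eq_integral do rewrite EFinM.
  rewrite ge0_integralZl ?gb 1?muleC ?lee_fin//; first exact/measurable_EFinP.
  by move=> y _; rewrite lee_fin.
rewrite ge0_integralZl ?fa 1?muleC//; first exact/measurable_EFinP.
  by move=> x _; rewrite lee_fin.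
by rewrite -gb integral_ge0// => y _; rewrite lee_fin.
Qed.

(** For [f] a squared likelihood ratio, this says that one plus the chi-square divergence is
    multiplicative over independent observations. *)
Lemma ge0_integral_sample_prod {d} {X : measurableType d} {R : realType}
    (P : probability X R) (f : X -> R) (a : R) n :
  measurable_fun [set: X] f -> (forall x, 0 <= f x)%R ->
  \int[P]_x (f x)%:E = a%:E ->
  \int[tprod P n]_w (sample_prod f w)%:E = (a ^+ n)%:E.
Proof.
move=> mf f0 fa; have mS k := @measurable_sample_prod _ X R f k mf.
have S0 k (w : k.-tuple X) : (0 <= sample_prod f w)%R by exact: prodr_ge0.
elim: n => [|n IH].
  rewrite expr0 -(expectation_cst (tprod P 0) 1%R) expectation.unlock.
  by apply: eq_integral => w _; rewrite /sample_prod big_ord0.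
rewrite /= ge0_integral_distribution//; last 2 first.
- by apply/measurable_EFinP; exact: mS.
- by move=> w; rewrite lee_fin.
rewrite exprS -(ge0_integral_prodM mf (mS n) f0 (S0 n) fa IH).
by apply: eq_integral => -[x w] _ /=; rewrite sample_prod_tcons.
Qed.

(* [h^2 - 2 l h (L - 1) + l^2 (L - 1)^2] is a square; optimizing over the free
   parameter l gives the usual form of the inequality. *)
Lemma chapman_robbins {d} {X : measurableType d} {R : realType}
    (P P' : probability X R) (L h : X -> R) (K delta l : R) :
  has_density P P' L -> \int[P]_x (L x ^+ 2)%:E = K%:E ->
  measurable_fun [set: X] h -> 'E_P[h] = 0 -> 'E_P'[h] = delta%:E ->
  (2 * l * delta - l ^+ 2 * (K - 1))%:E <= 'V_P[h].
Proof.
move=> [mL L0 LE] LK mh h0 hd.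
have [hoo|hoo] := eqVneq 'V_P[h] +oo; first by rewrite hoo leey.
have h2 : h \in Lfun P 2%:E by apply: variance_lty_Lfun2; rewrite // ltey.
have L2 : L \in Lfun P 2%:E by apply: sqr_lty_Lfun2; rewrite // LK ltry.
have h1 := Lfun2_Lfun1 h2; have L1 := Lfun2_Lfun1 L2.
have hL1 : (h \* L)%R \in Lfun P 1 by exact: Lfun2_mul_Lfun1.
have EL : 'E_P[L] = 1.
  rewrite -(expectation_cst P' 1%R) !expectation.unlock [RHS]LE//; last first.
    by apply/measurable_EFinP; exact: measurable_cst.
  by apply: eq_integral => x _; rewrite mul1e.
(* The density property covers nonnegative functions only, so [h] is split into its two parts;
   [L >= 0] lets the factor pass through the maxima. *)
have EhL : 'E_P[(h \* L)%R] = delta%:E.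
  rewrite -hd expectation.unlock integralE [RHS]integralE.
  have mE : measurable_fun [set: X] (EFin \o h) by exact/measurable_EFinP.
  rewrite (LE (EFin \o h)^\+)//; last exact: measurable_funepos.
  rewrite (LE (EFin \o h)^\-)//; last exact: measurable_funeneg.
  congr (_ - _); apply: eq_integral => x _.
    by rewrite !funeposE /= -!EFin_max -EFinM maxr_pMl// mul0r.
  by rewrite !funenegE /= -!EFin_max -EFinM maxr_pMl// mul0r mulNr.
have Lsq : (fun x => L x ^+ 2)%R \in Lfun P 1.
  exact/Lfun1_integrable/Lfun2_integrable_sqr.
have EL2 : 'E_P[(fun x => L x ^+ 2)%R] = K%:E by rewrite expectation.unlock.
rewrite (variance_integral h0).
(* [psi] is [2 l h (L - 1) - l ^ 2 (L - 1) ^ 2] multiplied out, so that only the means of [h L],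
   [h], [L ^ 2] and [L] enter. *)
pose psi := ((2 * l) \o* (h \* L) \+ ((- (2 * l)) \o* h \+
  ((- l ^+ 2) \o* (fun x => L x ^+ 2) \+
  ((2 * l ^+ 2) \o* L \+ cst (- l ^+ 2)))))%R.
have psi1 : psi \in Lfun P 1.
  by rewrite !Lfun_add ?Lfun_scale ?Lfun_cst.
have -> : (2 * l * delta - l ^+ 2 * (K - 1))%:E = 'E_P[psi].
  rewrite !expectationD ?Lfun_add ?Lfun_scale ?Lfun_cst//.
  rewrite expectation_cst.
  rewrite !(expectationZl _ hL1, expectationZl _ h1,
    expectationZl _ Lsq, expectationZl _ L1) EhL h0 EL EL2.
  rewrite mule0 -!EFinM add0e -!EFinD; congr EFin; ring.
rewrite expectation.unlock; apply: le_integral => //.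
- exact/Lfun1_integrable.
- under eq_fun do rewrite subr0.
  exact: Lfun2_integrable_sqr.
- move=> x _; rewrite lee_fin subr0 /psi /= -subr_ge0.
  rewrite [leRHS](_ : _ = (h x - l * (L x - 1)) ^+ 2)%R ?sqr_ge0//; ring.
Qed.

End density.

(** * The worst-case family *)

Section three_point_law.
Context {R : realType}.
Local Open Scope ereal_scope.

Section law.
Context (t : R) (t3 : (t ^+ 2 <= 3)%R).

Let wm_ge0 : (0 <= (1 - t) ^+ 2 / 8)%R.
Proof. by rewrite divr_ge0 ?sqr_ge0. Qed.
Let w0_ge0 : (0 <= (3 - t ^+ 2) / 4)%R.
Proof. by rewrite divr_ge0 ?subr_ge0. Qed.
Let wp_ge0 : (0 <= (1 + t) ^+ 2 / 8)%R.
Proof. by rewrite divr_ge0 ?sqr_ge0. Qed.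

(* Mean t and variance 1 on a support that does not depend on t. *)
Definition three_point : set R -> \bar R :=
  measure_add
    [the measure _ _ of measure_add
      [the measure _ _ of mscale (NngNum wm_ge0) \d_((- 2)%R : R)]
      [the measure _ _ of mscale (NngNum w0_ge0) \d_(0%R : R)]]
    [the measure _ _ of mscale (NngNum wp_ge0) \d_(2%R : R)].

HB.instance Definition _ := Measure.on three_point.

Let three_point_setT : three_point [set: R] = 1.
Proof.
rewrite /three_point measure_addE [X in X + _]measure_addE/= /mscale/= !diracT !mule1.
by rewrite -!EFinD; congr EFin; field.
Qed.

HB.instance Definition _ :=
  Measure_isProbability.Build _ _ _ three_point three_point_setT.

Definition three_point_mean (f : R -> R) : R :=
  ((1 - t) ^+ 2 / 8 * f (- 2) + (3 - t ^+ 2) / 4 * f 0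
    + (1 + t) ^+ 2 / 8 * f 2)%R.

Lemma ge0_integral_three_point (F : R -> \bar R) :
  measurable_fun [set: R] F -> (forall x, 0 <= F x) ->
  \int[three_point]_x F x =
    ((1 - t) ^+ 2 / 8)%:E * F (- 2)%R + ((3 - t ^+ 2) / 4)%:E * F 0%R
    + ((1 + t) ^+ 2 / 8)%:E * F 2%R.
Proof.
move=> mF F0; rewrite /three_point !ge0_integral_measure_add//.
by rewrite !ge0_integral_mscale// !integral_dirac// !diracT !mul1e.
Qed.

Lemma expectation_three_point (f : R -> R) : measurable_fun [set: R] f ->
  'E_three_point[f] = (three_point_mean f)%:E.
Proof.
move=> mf; have mE : measurable_fun [set: R] (EFin \o f).
  exact/measurable_EFinP.
rewrite expectation.unlock integralE !ge0_integral_three_point//; last 2 first.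
- exact: measurable_funeneg.
- exact: measurable_funepos.
rewrite !funeposE !funenegE /= -!EFin_max -!EFinM -!EFinD -?EFinB.
(* Rewriting positive parts through negative ones makes the negative parts cancel in the difference,
   which [ring] then sees. *)
have maxE (x : R) : Num.max x 0%R = (x + Num.max (- x) 0)%R.
  by rewrite /Num.max; do 2 case: ifPn; lra.
by rewrite /three_point_mean !(maxE (f _)); congr EFin; ring.
Qed.

End law.

Lemma expectation_three_point_prod (t u : R) (t3 : (t ^+ 2 <= 3)%R)
    (u3 : (u ^+ 2 <= 3)%R) (F : R * R -> R) :
  measurable_fun [set: R * R] F ->
  'E_(three_point t3 \x three_point u3)[F] =
    (three_point_mean t (fun x => three_point_mean u (fun y => F (x, y))))%:E.
Proof.
move=> mF.
have mFx (x : R) : measurable_fun [set: R] (fun y => F (x, y)).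
  exact: measurableT_comp.
have mFy (y : R) : measurable_fun [set: R] (fun x => F (x, y)).
  exact: measurableT_comp.
have mm (G : R * R -> R) : measurable_fun [set: R * R] G ->
    measurable_fun [set: R] (fun x => three_point_mean u (fun y => G (x, y))).
  move=> mG; rewrite /three_point_mean.
  by apply: measurable_funD; first apply: measurable_funD;
    apply: measurable_funM => //; exact: measurableT_comp.
have intE (G : R * R -> R) : measurable_fun [set: R * R] G ->
    \int[three_point t3]_x \int[three_point u3]_y (G (x, y))%:E =
    (three_point_mean t (fun x => three_point_mean u (fun y => G (x, y))))%:E.
  move=> mG; rewrite -expectation_three_point; last exact: mm.
  rewrite [in RHS]expectation.unlock; apply: eq_integral => x _.
  rewrite -expectation_three_point ?expectation.unlock//.
  exact: measurableT_comp.
rewrite expectation.unlock -integral12_prod_meas1 ?intE//.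
(* Integrability holds because the iterated integral of the absolute value is given by the same
   finite formula. *)
apply/(integrable12ltyP _ _ _).2; first exact/measurable_EFinP.
rewrite /= (intE (fun p => `|F p|)%R) ?ltry//.
exact: measurableT_comp.
Qed.

(** The quadratic polynomial that interpolates the ratios of the weights for mean [t] to those for
    mean [0] at the points -2, 0 and 2. *)
Definition three_point_ratio (t x : R) : R :=
  (1 + t * x + t ^+ 2 * (x ^+ 2 - 1) / 3)%R.

Lemma measurable_three_point_ratio t :
  measurable_fun [set: R] (three_point_ratio t).
Proof.
rewrite /three_point_ratio; apply: measurable_funD.
  by apply: measurable_funD => //; exact: measurable_funM.
apply: measurable_funM => //; apply: measurable_funM => //.
by apply: measurable_funB => //; exact: measurable_funX.
Qed.

Lemma has_density_three_point (t : R) (t3 : (t ^+ 2 <= 3)%R)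
    (o3 : (0 ^+ 2 <= 3 :> R)%R) : (t ^+ 2 <= 3 / 4)%R ->
  has_density (three_point o3) (three_point t3) (three_point_ratio t).
Proof.
move=> t34; have mL := measurable_three_point_ratio t.
have L0 x : (0 <= three_point_ratio t x)%R.
  (* Completing the square, the ratio is [(t x + 3/2) ^ 2 / 3 + (3/4 - t ^ 2) / 3]; hence the bound
     [3 / 4], which gives nonnegativity on the whole line. *)
  rewrite /three_point_ratio; have := sqr_ge0 (t * x + 3 / 2)%R.
  by move: t34; nra.
split=> // F mF F0.
rewrite !ge0_integral_three_point//; last 2 first.
- by apply: emeasurable_funM => //; exact/measurable_EFinP.
- by move=> x; rewrite mule_ge0// lee_fin.
rewrite ![_%:E * (F _ * _)]muleCA -!EFinM /three_point_ratio.
by congr (_ + _ + _); rewrite muleC; congr (_ * _%:E); field.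
Qed.

(** Under the centred law, [1], [x] and [x ^ 2 - 1] are orthogonal with squared norms 1, 1 and 3. *)
Lemma integral_three_point_ratio_sqr (t : R) (o3 : (0 ^+ 2 <= 3 :> R)%R) :
  \int[three_point o3]_x (three_point_ratio t x ^+ 2)%:E =
    (1 + t ^+ 2 + t ^+ 4 / 3)%:E.
Proof.
have := @expectation_three_point _ o3 (fun x => three_point_ratio t x ^+ 2)%R.
rewrite expectation.unlock => ->.
  by rewrite /three_point_mean /three_point_ratio; congr EFin; field.
by apply: measurable_funX; exact: measurable_three_point_ratio.
Qed.

End three_point_law.

Section worst_case_model.
Context {R : realType}.

(** The coordinates of [p] are the metric [g], the hidden part [xi] of the human metric and the
    judgment noise [e]; the input [z] is the pair of the first two. *)
Definition judgment (alpha b s : R) (p : R * R * R) : R :=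
  alpha * p.1.1 + b * p.1.2 + s * p.2.

Lemma measurable_judgment alpha b s :
  measurable_fun [set: R * R * R] (judgment alpha b s).
Proof.
rewrite /judgment; apply: measurable_funD; first apply: measurable_funD.
- by apply: measurable_funM => //; exact: measurableT_comp.
- by apply: measurable_funM => //; exact: measurableT_comp.
- exact: measurable_funM.
Qed.

Context (alpha b s a c : R) (o3 : 0 ^+ 2 <= 3 :> R) (a3 : a ^+ 2 <= 3)
  (c3 : c ^+ 2 <= 3).
Let Pz : probability (R * R)%type R := (three_point o3 \x three_point a3)%E.
Let Q : probability R R := three_point c3.
Let phi := judgment alpha b s.
Local Open Scope ereal_scope.

Let mphi : measurable_fun [set: R * R * R] phi.
Proof. exact: measurable_judgment. Qed.

Let mYz z : measurable_fun [set: R] (Yz phi z).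
Proof. exact: measurableT_comp. Qed.

Let EYz z : 'E_Q[Yz phi z] = (alpha * z.1 + b * z.2 + s * c)%:E.
Proof.
rewrite expectation_three_point//; congr EFin.
by rewrite /three_point_mean /Yz /phi /judgment /=; field.
Qed.

Let hmetricE :
  hmetric Q phi = (fun z => alpha * z.1 + b * z.2 + s * c)%R.
Proof. by apply/funext => z; rewrite /hmetric EYz. Qed.

Let mh : measurable_fun [set: R * R] (hmetric Q phi).
Proof. exact: measurable_hmetric. Qed.

Let Ehmetric : 'E_Pz[hmetric Q phi] = (b * a + s * c)%:E.
Proof.
rewrite expectation_three_point_prod// hmetricE; congr EFin.
by rewrite /three_point_mean /=; field.
Qed.

Let mfst : measurable_fun [set: R * R] (@fst R R).
Proof. exact: measurable_fst. Qed.

Let Efst : 'E_Pz[@fst R R] = 0%:E.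
Proof.
rewrite expectation_three_point_prod//; congr EFin.
by rewrite /three_point_mean /=; field.
Qed.

Let variance_Pz (f : R * R -> R) (m : R) : measurable_fun [set: R * R] f ->
  'E_Pz[f] = m%:E ->
  'V_Pz[f] = (three_point_mean 0 (fun x =>
     three_point_mean a (fun y => (f (x, y) - m) ^+ 2)))%:E.
Proof.
move=> mf fm; rewrite (variance_integral fm).
have := @expectation_three_point_prod _ _ _ o3 a3 (fun z => (f z - m) ^+ 2)%R.
rewrite expectation.unlock => -> //.
by apply: measurable_funX; exact: measurable_funB.
Qed.

Lemma target_judgment : target Pz Q phi = (b * a + s * c)%:E.
Proof. exact: Ehmetric. Qed.

(** The three-point laws have variance 1 for every mean, so the shifts [a] and [c] change neither
    variances nor the covariance, while [target_judgment] shows that they move the target. *)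
Lemma in_class_judgment (sf : R) : (b ^+ 2 = sf ^+ 2 - alpha ^+ 2)%R ->
  in_class Pz Q phi (@fst R R) sf (s ^+ 2) alpha.
Proof.
move=> bE.
have sqY z : \int[Q]_u ((Yz phi z u - (alpha * z.1 + b * z.2 + s * c)) ^+ 2)%:E
    = (s ^+ 2)%:E.
  have := @expectation_three_point _ _ c3
    (fun u => (Yz phi z u - (alpha * z.1 + b * z.2 + s * c)) ^+ 2)%R.
  rewrite expectation.unlock => ->.
    by congr EFin; rewrite /three_point_mean /Yz /phi /judgment /=; field.
  by apply: measurable_funX; exact: measurable_funB.
have VYz z : 'V_Q[Yz phi z] = (s ^+ 2)%:E.
  by rewrite (variance_integral (EYz z)).
split=> //.
- split=> //; rewrite (variance_Pz mfst Efst); congr EFin.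
  by rewrite /three_point_mean /=; field.
- by move=> z; apply: variance_lty_Lfun2; rewrite // VYz ltry.
- split.
    rewrite (variance_Pz mh Ehmetric) hmetricE; congr EFin.
    have -> : (sf ^+ 2 = b ^+ 2 + alpha ^+ 2)%R by rewrite bE subrK.
    by rewrite /three_point_mean /=; field.
  have -> : condvar Q phi = cst (s ^+ 2)%R.
    by apply/funext => z; rewrite /condvar VYz.
  by rewrite expectation_cst.
- rewrite covariance.unlock Ehmetric Efst.
  rewrite -[X in expectation _ X]/(fun z : R * R =>
    (hmetric Q phi z - (b * a + s * c)) * (z.1 - 0))%R.
  rewrite expectation_three_point_prod.
    by congr EFin; rewrite /three_point_mean hmetricE /=; field.
  by apply: measurable_funM; exact: measurable_funB.
Qed.

End worst_case_model.

(** * Likelihood ratio between the shifted and the centred model *)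

Section likelihood_ratio.
Context {R : realType}.

(** With [u = t ^ 2 / 3] the left side is [1 + 3 u + 3 u ^ 2], at most [(1 + u) ^ 3], hence at most
    [exp (3 u)]. In exponential form the bounds for several coordinates and observations simply add
    in the exponent. *)
Lemma three_point_ratio_moment_le (t : R) :
  1 + t ^+ 2 + t ^+ 4 / 3 <= expR (t ^+ 2).
Proof.
set u := t ^+ 2 / 3.
have u0 : 0 <= u by rewrite divr_ge0 ?sqr_ge0.
have -> : t ^+ 2 = u + u + u by rewrite /u; field.
rewrite !expRD; apply: (@le_trans _ _ ((1 + u) ^+ 3)).
  have -> : t ^+ 4 = 9 * u ^+ 2 by rewrite /u; field.
  have : 0 <= u ^+ 3 by exact: exprn_ge0.
  have -> : (1 + u) ^+ 3 = 1 + (u + u + u) + 9 * u ^+ 2 / 3 + u ^+ 3 by field.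
  by rewrite lerDl.
by rewrite -!expr2 -exprSr lerXn2r ?nnegrE ?expR_ge1Dx ?expR_ge0 ?addr_ge0.
Qed.

(** The shift 0 in the first factor records that [g] keeps its centred law; the nesting follows
    [has_density_prod]. *)
Definition judgment_ratio (a c : R) (p : R * R * R) : R :=
  three_point_ratio 0 p.1.1 * three_point_ratio a p.1.2 *
  three_point_ratio c p.2.

Context (a c : R) (o3 : 0 ^+ 2 <= 3 :> R) (a3 : a ^+ 2 <= 3)
  (c3 : c ^+ 2 <= 3).
Let P0 : probability (R * R * R)%type R :=
  ((three_point o3 \x three_point o3) \x three_point o3)%E.
Let P1 : probability (R * R * R)%type R :=
  ((three_point o3 \x three_point a3) \x three_point c3)%E.

Lemma has_density_judgment : a ^+ 2 <= 3 / 4 -> c ^+ 2 <= 3 / 4 ->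
  has_density P0 P1 (judgment_ratio a c).
Proof.
move=> a34 c34; have o34 : 0 ^+ 2 <= 3 / 4 :> R.
  by rewrite expr0n divr_ge0.
exact: (has_density_prod
  (has_density_prod (has_density_three_point o3 o3 o34)
                    (has_density_three_point a3 o3 a34))
  (has_density_three_point c3 o3 c34)).
Qed.

Lemma integral_judgment_ratio_sqr :
  (\int[P0]_p (judgment_ratio a c p ^+ 2)%:E =
  ((1 + a ^+ 2 + a ^+ 4 / 3) * (1 + c ^+ 2 + c ^+ 4 / 3))%:E)%E.
Proof.
pose q t x : R := three_point_ratio t x ^+ 2.
have mq t : measurable_fun [set: R] (q t).
  by apply: measurable_funX; exact: measurable_three_point_ratio.
have q0 t x : 0 <= q t x by exact: sqr_ge0.
have qE t : (\int[three_point o3]_x (q t x)%:E = (1 + t ^+ 2 + t ^+ 4 / 3)%:E)%E.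
  exact: integral_three_point_ratio_sqr.
have mqq : measurable_fun [set: R * R] (fun z => q 0 z.1 * q a z.2).
  by apply: measurable_funM; exact: measurableT_comp.
have qq0 (z : R * R) : 0 <= q 0 z.1 * q a z.2 by rewrite mulr_ge0.
have := ge0_integral_prodM mqq (mq c) qq0 (q0 c)
  (ge0_integral_prodM (mq 0) (mq a) (q0 0) (q0 a) (qE 0) (qE a)) (qE c).
rewrite !expr0n mul0r !addr0 mul1r => <-.
by apply: eq_integral => p _; rewrite /judgment_ratio !exprMn.
Qed.

End likelihood_ratio.

(** * Measurability of estimators and the bound for a small shift *)

Lemma sample_prod_sqr {X : Type} {R : realType} (L : X -> R) n
    (w : n.-tuple X) :
  sample_prod L w ^+ 2 = sample_prod (fun x => L x ^+ 2) w.
Proof. by rewrite /sample_prod -prodrXl. Qed.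

Lemma measurable_estimator {dT dU} {T : measurableType dT}
    {U : measurableType dU} {R : realType} (phi : T * U -> R) (g : T -> R)
    n (h : n.-tuple (R * R) -> R) :
  measurable_fun [set: T * U] phi -> measurable_fun [set: T] g ->
  measurable_fun [set: n.-tuple (R * R)] h ->
  measurable_fun [set: n.-tuple (T * U)] (estimator phi g h).
Proof.
move=> mphi mg mh; apply: measurableT_comp => //.
apply/measurable_fun_tnthP => i.
have -> : (tnth (T:=R * R))^~ i \o observations phi g (n:=n) =
    (fun p => (phi p, g p.1)) \o (fun w => tnth w i).
  by apply/funext => w; rewrite /= tnth_map.
apply: measurableT_comp; last exact: measurable_tnth.
apply: measurable_fun_pair; first exact: mphi.
by apply: measurableT_comp; [exact: mg|exact: measurable_fst].
Qed.

(** The optimal parameter [tau v / (K ^ n - 1)] is [1 / (n tau)] to leading order, and the latter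
    also makes sense for [v = 0]. With [x = n v tau ^ 2] the terms are [2 v / n - v / n], up to an
    error of at most [2 v ^ 2 tau ^ 2]. *)
Lemma chapman_robbins_small_shift (R : realType) (v eps tau : R) (n : nat) (K : R) :
  (0 < n)%N -> 0 < tau -> 0 <= K -> K <= expR (tau ^+ 2 * v) ->
  n%:R * v * tau ^+ 2 <= 1 / 2 -> 2 * v ^+ 2 * tau ^+ 2 <= eps -> 0 <= v ->
  n%:R^-1 * v - eps <=
  2 * (n%:R * tau)^-1 * (tau * v) - (n%:R * tau)^-1 ^+ 2 * (K ^+ n - 1).
Proof.
move=> n0 tau0 K0 Kexp; set x := n%:R * v * tau ^+ 2 => x2 veps v0.
have nR : 0 < n%:R :> R by rewrite ltr0n.
have x0 : 0 <= x by rewrite !mulr_ge0 ?sqr_ge0// ltW.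
have Kx : K ^+ n <= 1 + x + 2 * x ^+ 2.
  apply: (@le_trans _ _ (expR x)).
    rewrite /x (_ : _ * _ = n%:R * (tau ^+ 2 * v)); last by ring.
    by rewrite expRM_natl lerXn2r ?nnegrE ?expR_ge0.
  (* From [exp x * (1 - x) <= 1], and [(1 - x) (1 + x + 2 x ^ 2) = 1 + x ^ 2 (1 - 2 x) >= 1] for
     [x <= 1/2]. *)
  have E0 := expR_gt0 x.
  have : expR x * (1 - x) <= 1.
    rewrite -[leRHS](expRxMexpNx_1 x) ler_pM2l//.
    by have := expR_ge1Dx (- x).
  by move: E0 x2 x0; set e := expR x; nra.
have nt0 : 0 < n%:R * tau by rewrite mulr_gt0.
have lx : (n%:R * tau)^-1 ^+ 2 * (K ^+ n - 1) <=
    (n%:R * tau)^-1 ^+ 2 * (x + 2 * x ^+ 2).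
  by rewrite ler_wpM2l ?sqr_ge0//; lra.
have -> : 2 * (n%:R * tau)^-1 * (tau * v) = 2 * (n%:R^-1 * v).
  by field; rewrite !gt_eqF.
have xE : (n%:R * tau)^-1 ^+ 2 * (x + 2 * x ^+ 2) =
    n%:R^-1 * v + 2 * v ^+ 2 * tau ^+ 2.
  by rewrite /x; field; rewrite !gt_eqF.
by move: lx; rewrite xE; lra.
Qed.

Unset Implicit Arguments.

Theorem theorem1 (R : realType) (sf sa2 alpha : R) (n : nat) :
  0 < sf -> 0 <= sa2 -> `|alpha| <= sf -> (0 < n)%N ->
  (* (i) variance of the control variates estimator on the class C *)
  (forall (dT : measure_display) (T : measurableType dT)
          (dU : measure_display) (U : measurableType dU)
          (Pz : probability T R) (Q : probability U R)
          (phi : T * U -> R) (g : T -> R),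
     in_class Pz Q phi g sf sa2 alpha ->
     'V_(sampleP Pz Q n)[mu_cv phi g alpha (n:=n)] =
       (cv_bound sf sa2 alpha n)%:E)
  /\
  (* (ii) minimax lower bound for every estimator that is unbiased on C *)
  (forall h : n.-tuple (R * R) -> R,
     measurable_fun [set: n.-tuple (R * R)] h ->
     (forall (dT : measure_display) (T : measurableType dT)
             (dU : measure_display) (U : measurableType dU)
             (Pz : probability T R) (Q : probability U R)
             (phi : T * U -> R) (g : T -> R),
        in_class Pz Q phi g sf sa2 alpha ->
        ('E_(sampleP Pz Q n)[estimator phi g h] = target Pz Q phi)%E) ->
     forall eps : R, 0 < eps ->
     exists (dT : measure_display) (T : measurableType dT)
            (dU : measure_display) (U : measurableType dU)
            (Pz : probability T R) (Q : probability U R)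
            (phi : T * U -> R) (g : T -> R),
       in_class Pz Q phi g sf sa2 alpha /\
       ((cv_bound sf sa2 alpha n - eps)%:E <=
          'V_(sampleP Pz Q n)[estimator phi g h])%E).
Proof.
move=> sf0 sa20 al_sf n0; split.
  move=> dT T dU U Pz Q phi g C.
  have [[mphi mg] _ phi2 _ _] := C.
  have [X2 VX] := variance_residual mphi phi2 C.
  rewrite -[LHS]/('V_(tprod (Pz \x Q)%E n)[(fun w => n%:R^-1 *
    sample_sum (fun p => phi p - alpha * g p.1)%R w)%R])%E.
  rewrite variance_sample_mean// VX /cv_bound -EFinM; congr EFin.
  by field; rewrite !gt_eqF ?ltr0n.
move=> h mh unb eps eps0.
pose b := Num.sqrt (sf ^+ 2 - alpha ^+ 2); pose s := Num.sqrt sa2.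
have bE : b ^+ 2 = sf ^+ 2 - alpha ^+ 2.
  rewrite sqr_sqrtr//; move: al_sf; rewrite ler_norml => /andP[].
  by clear - sf0; nra.
have sE : s ^+ 2 = sa2 by rewrite sqr_sqrtr.
pose v := b ^+ 2 + s ^+ 2.
have v0 : 0 <= v by rewrite addr_ge0 ?sqr_ge0.
have cvE : cv_bound sf sa2 alpha n = n%:R^-1 * v.
  rewrite /cv_bound /v bE sE; field.
  by rewrite !gt_eqF ?ltr0n.
have nR : 1 <= n%:R :> R by rewrite ler1n.
(* The three summands of [D] force [tau <= 1], [2 n v tau <= 1] and [2 v ^ 2 tau <= eps] for
   [tau = 1 / D]; since [tau ^ 2 <= tau], the bounds also hold with [tau ^ 2]. *)
pose D := 1 + 2 * n%:R * v + 2 * v ^+ 2 / eps.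
have D1 : 0 <= 2 * n%:R * v by rewrite !mulr_ge0.
have D2 : 0 <= 2 * v ^+ 2 / eps 
  by rewrite divr_ge0 ?mulr_ge0 ?sqr_ge0 ?(ltW eps0).
have D0 : 0 < D by rewrite /D; lra.
pose tau := D^-1.
have tau0 : 0 < tau by rewrite invr_gt0.
have tauD : tau * D = 1 by rewrite mulVf ?gt_eqF.
have tau1 : tau <= 1 by rewrite invf_le1// /D; lra.
have tau2 : tau ^+ 2 <= tau by rewrite expr2 ger_pMl.
have tv : n%:R * v * tau ^+ 2 <= 1 / 2.
  have : n%:R * v * tau ^+ 2 <= n%:R * v * tau by rewrite ler_wpM2l ?mulr_ge0.
  have : tau * (1 + 2 * v ^+ 2 / eps) >= 0 by rewrite mulr_ge0 ?addr_ge0// ltW.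
  by move: tauD; rewrite /D; lra.
have te : 2 * v ^+ 2 * tau ^+ 2 <= eps.
  have : 2 * v ^+ 2 * tau ^+ 2 <= 2 * v ^+ 2 * tau.
    by rewrite ler_wpM2l ?mulr_ge0 ?sqr_ge0.
  have : tau * (1 + 2 * n%:R * v) >= 0 by rewrite mulr_ge0 ?addr_ge0// ltW.
  have : 2 * v ^+ 2 * tau = eps * (tau * (2 * v ^+ 2 / eps)).
    by field; rewrite gt_eqF.
  have : eps * (tau * (2 * v ^+ 2 / eps)) <= eps * 1.
    by rewrite ler_pM2l// -[leRHS]tauD ler_pM2l// /D lerDr addr_ge0.
  by lra.
have vt : v * tau ^+ 2 <= 1 / 2.
  apply: le_trans tv; rewrite -mulrA ler_peMl//.
  by rewrite mulr_ge0 ?sqr_ge0.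
have a34 : (b * tau) ^+ 2 <= 3 / 4.
  have : 0 <= s ^+ 2 * tau ^+ 2 by rewrite mulr_ge0 ?sqr_ge0.
  by move: vt; rewrite exprMn /v mulrDl; lra.
have c34 : (s * tau) ^+ 2 <= 3 / 4.
  have : 0 <= b ^+ 2 * tau ^+ 2 by rewrite mulr_ge0 ?sqr_ge0.
  by move: vt; rewrite exprMn /v mulrDl; lra.
have o3 : 0 ^+ 2 <= 3 :> R by rewrite expr0n.
have a3 : (b * tau) ^+ 2 <= 3 by apply: le_trans a34 _; lra.
have c3 : (s * tau) ^+ 2 <= 3 by apply: le_trans c34 _; lra.
have cls a c (ha : a ^+ 2 <= 3) (hc : c ^+ 2 <= 3) :=
  @in_class_judgment R alpha b s a c o3 ha hc sf bE.
(* Both models share the functions [judgment] and [fst] and differ only in the underlying laws, so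
   unbiasedness gives two means, [0] and [tau v], of one and the same function of the sample. *)
have C0 := cls 0 0 o3 o3; have C1 := cls _ _ a3 c3.
rewrite sE in C0 C1.
have E0 := unb _ _ _ _ _ _ _ _ C0; have E1 := unb _ _ _ _ _ _ _ _ C1.
rewrite target_judgment !mulr0 addr0 in E0; rewrite target_judgment in E1.
(* The centred model is the witness; the shifted one enters only through the mean of the
   estimator. *)
do 4 eexists; exists (three_point o3 \x three_point o3)%E; exists (three_point o3).
exists (judgment alpha b s); exists fst; split; first exact: C0.
have dens := has_density_judgment o3 a3 c3 a34 c34.
have [mL _ _] := dens.
have Lsq := integral_judgment_ratio_sqr (b * tau) (s * tau) o3.
have := ge0_integral_sample_prod n
  (measurable_funX 2 mL) (fun=> sqr_ge0 _) Lsq.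
under eq_integral do rewrite -sample_prod_sqr.
move=> LnE.
have mest : measurable_fun [set: n.-tuple (R * R * R)]
    (estimator (judgment alpha b s) fst h).
  apply: measurable_estimator => //; exact: measurable_judgment.
have := chapman_robbins (n%:R * tau)^-1 (has_density_tprod n dens) LnE mest E0 E1.
apply: le_trans; rewrite lee_fin cvE.
have -> : b * (b * tau) + s * (s * tau) = tau * v by rewrite /v; ring.
have K0 t : 0 <= 1 + t ^+ 2 + t ^+ 4 / 3 :> R.
  by rewrite !addr_ge0 ?divr_ge0 ?sqr_ge0 ?exprn_even_ge0.
apply: chapman_robbins_small_shift => //.
- by rewrite mulr_ge0.
(* The exponent is the sum of the two squared shifts, one for each factor of the second moment. *)
- rewrite (_ : tau ^+ 2 * v = (b * tau) ^+ 2 + (s * tau) ^+ 2); last first.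
    by rewrite /v; ring.
  by rewrite expRD ler_pM ?three_point_ratio_moment_le.
Qed.
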